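(* Let $n\ge 1$ and let $\Bbbk$ be a field. For every $X,Y\in P_1([n])$ we have $$\dim_{\Bbbk}\mathrm{Hom}(\Bbbk L_Y,\Bbbk L_X)=|\widetilde{H}_{Y,X}|,$$ where $\mathrm{Hom}$ denotes homomorphisms of left $\Bbbk\mathrm{OD}_n$-modules.
   Context: $[n]=\{1,\dots,n\}$, and $\mathrm{OD}_n$ is the monoid (under composition, $(fg)(x)=f(g(x))$) of all functions $f:[n]\to[n]$ that are order-preserving or order-reversing. $P_1([n])$ is the set of subsets $X\subseteq[n]$ with $1\in X$. The kernel classes (fibres) of $f\in\mathrm{OD}_n$ are intervals; the kernel set of $f$ is the set of minimal elements of its kernel classes. For $X\in P_1([n])$ and $W\subseteq[n]$ with $|W|=|X|$, $f^{\mathbf 1}_{W,X}$ (resp. $f^{-\mathbf 1}_{W,X}$) is the unique order-preserving (resp. order-reversing) function with kernel set $X$ and image $W$; the two coincide iff $|X|=1$. Define $$\widetilde{H}_{Y,X}=\{f^{\alpha}_{W,X}\in\mathrm{OD}_n\mid \alpha\in\{\mathbf 1,-\mathbf 1\},\ W\subseteq[n],\ |W|=|X|,\ W\cup\{1\}=Y\}.$$ $L_X$ is the set of all $f\in\mathrm{OD}_n$ with kernel set $X$ (an $\mathcal{L}$-class), and $\Bbbk L_X$ is the $\Bbbk$-vector space with basis $L_X$ and left $\Bbbk\mathrm{OD}_n$-module structure determined by $s\bullet x=sx$ if $sx\in L_X$ and $0$ otherwise ($s\in\mathrm{OD}_n$, $x\in L_X$). *)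

(* Defs.v *)
From HB Require Import structures.
From mathcomp Require Import all_boot all_order all_fingroup all_algebra.

Set Implicit Arguments.
Unset Strict Implicit.
Unset Printing Implicit Defensive.

Import GRing.Theory.
Local Open Scope ring_scope.

(* [n] = {1, ..., n} is represented by 'I_n = {0, ..., n - 1}, so the
   point 1 of [n] is the ordinal of value 0.                                         *)

Section Monotone.
Variable n : nat.
Implicit Types f g : {ffun 'I_n -> 'I_n}.

Definition order_preserving f :=
  [forall i : 'I_n, forall j : 'I_n, (i <= j)%N ==> (f i <= f j)%N].

Definition order_reversing f :=
  [forall i : 'I_n, forall j : 'I_n, (i <= j)%N ==> (f j <= f i)%N].

Lemma order_preservingP f :
  reflect (forall i j : 'I_n, (i <= j)%N -> (f i <= f j)%N)
          (order_preserving f).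
Proof.
apply: (iffP forallP) => [H i j|H i]; last by apply/forallP => j; apply/implyP/H.
by have /forallP/(_ j)/implyP := H i.
Qed.

Lemma order_reversingP f :
  reflect (forall i j : 'I_n, (i <= j)%N -> (f j <= f i)%N)
          (order_reversing f).
Proof.
apply: (iffP forallP) => [H i j|H i]; last by apply/forallP => j; apply/implyP/H.
by have /forallP/(_ j)/implyP := H i.
Qed.

Record OD := MkOD {
  od_fun :> {ffun 'I_n -> 'I_n};
  od_monotone : order_preserving od_fun || order_reversing od_fun }.

HB.instance Definition _ := [isSub for od_fun].
HB.instance Definition _ := [Finite of OD by <:].

Fact od_one_subproof :
  order_preserving [ffun i => i] || order_reversing [ffun i => i].
Proof.
by apply/orP; left; apply/order_preservingP => i j le_ij; rewrite !ffunE.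
Qed.

Fact od_mul_subproof (f g : OD) :
  order_preserving [ffun i => f (g i)] || order_reversing [ffun i => f (g i)].
Proof.
have /orP[/order_preservingP Hf|/order_reversingP Hf] := od_monotone f;
  have /orP[/order_preservingP Hg|/order_reversingP Hg] := od_monotone g;
  apply/orP.
- by left; apply/order_preservingP => i j /Hg/Hf; rewrite !ffunE.
- by right; apply/order_reversingP => i j /Hg/Hf; rewrite !ffunE.
- by right; apply/order_reversingP => i j /Hg/Hf; rewrite !ffunE.
- by left; apply/order_preservingP => i j /Hg/Hf; rewrite !ffunE.
Qed.

Definition od_one : OD := MkOD od_one_subproof.
Definition od_mul (f g : OD) : OD := MkOD (od_mul_subproof f g).

Fact od_mulA : associative od_mul.
Proof. by move=> f g h; apply/val_inj/ffunP => i; rewrite !ffunE. Qed.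

Fact od_mul1g : left_id od_one od_mul.
Proof. by move=> f; apply/val_inj/ffunP => i; rewrite !ffunE. Qed.

Fact od_mulg1 : right_id od_one od_mul.
Proof. by move=> f; apply/val_inj/ffunP => i; rewrite !ffunE. Qed.

HB.instance Definition _ := isMonoid.Build OD od_mulA od_mul1g od_mulg1.

Definition kernel_set f : {set 'I_n} :=
  [set i | [forall j, (f j == f i) ==> (i <= j)%N]].

Definition image_set f : {set 'I_n} := [set f i | i : 'I_n].

Lemma od_mulE (f g : OD) i : (f * g)%g i = f (g i).
Proof. by rewrite ffunE. Qed.

Lemma kernel_set_mul (s f : OD) : kernel_set (s * f)%g \subset kernel_set f.
Proof.
apply/subsetP => i; rewrite !inE => /forallP H.
apply/forallP => j; apply/implyP => /eqP Eji.
by have /implyP := H j; rewrite !od_mulE Eji eqxx; apply.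
Qed.

End Monotone.

Section Htilde.
Variables (n : nat) (hn : (0 < n)%N).

Definition one : 'I_n := Ordinal hn.

Definition P1 : {set {set 'I_n}} := [set X : {set 'I_n} | one \in X].

(* f is the unique order-preserving (alpha = true) or order-reversing
   (alpha = false) function with kernel set X and image W.                    *)
Definition is_fWX (alpha : bool) (W X : {set 'I_n}) (f : OD n) : bool :=
  [&& (if alpha then order_preserving f else order_reversing f),
      kernel_set f == X & image_set f == W].

Definition Htilde (Y X : {set 'I_n}) : {set OD n} :=
  [set f | [exists alpha : bool, exists W : {set 'I_n},
     [&& is_fWX alpha W X f, #|W| == #|X| & W :|: [set one] == Y]]].

End Htilde.

Section Bilinear.
Variables (K : fieldType) (I J : finType) (V : lmodType K).
Implicit Types (a : {ffun I -> K^o}) (b : {ffun J -> K^o}) (g : I -> J -> V).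

Definition basis (T : finType) (t : T) : {ffun T -> K^o} :=
  [ffun u => (u == t)%:R].

(* The bilinear map sending (basis i, basis j) to g i j. *)
Definition bilinear_ext g a b : V := \sum_i \sum_j (a i * b j) *: g i j.

Lemma bilinear_extDl g a a' b :
  bilinear_ext g (a + a') b = bilinear_ext g a b + bilinear_ext g a' b.
Proof.
rewrite -big_split; apply: eq_bigr => i _ /=; rewrite -big_split.
by apply: eq_bigr => j _ /=; rewrite ffunE mulrDl scalerDl.
Qed.

Lemma bilinear_extDr g a b b' :
  bilinear_ext g a (b + b') = bilinear_ext g a b + bilinear_ext g a b'.
Proof.
rewrite -big_split; apply: eq_bigr => i _ /=; rewrite -big_split.
by apply: eq_bigr => j _ /=; rewrite ffunE mulrDr scalerDl.
Qed.

Lemma bilinear_extZl g c a b :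
  bilinear_ext g (c *: a) b = c *: bilinear_ext g a b.
Proof.
rewrite scaler_sumr; apply: eq_bigr => i _ /=; rewrite scaler_sumr.
by apply: eq_bigr => j _ /=; rewrite ffunE scalerA mulrA.
Qed.

Lemma bilinear_extZr g c a b :
  bilinear_ext g a (c *: b) = c *: bilinear_ext g a b.
Proof.
rewrite scaler_sumr; apply: eq_bigr => i _ /=; rewrite scaler_sumr.
by apply: eq_bigr => j _ /=; rewrite ffunE scalerA mulrCA.
Qed.

Lemma bilinear_ext_basis g i j : bilinear_ext g (basis i) (basis j) = g i j.
Proof.
rewrite /bilinear_ext (bigD1 i) //= (bigD1 j) //= !ffunE !eqxx mulr1 scale1r.
rewrite !big1 ?addr0 // => [i' /negPf ne|j' /negPf ne].
  by rewrite big1 // => j' _; rewrite !ffunE ne mul0r scale0r.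
by rewrite !ffunE ne mulr0 scale0r.
Qed.

Lemma bilinear_ext_suml g b (T : finType) (c : T -> K) (F : T -> {ffun I -> K^o}) :
  bilinear_ext g (\sum_t c t *: F t) b = \sum_t c t *: bilinear_ext g (F t) b.
Proof.
apply: (big_ind2 (fun x y => bilinear_ext g x b = y)).
- by have := bilinear_extZl g 0 0 b; rewrite !scale0r.
- by move=> x y x' y' <- <-; rewrite bilinear_extDl.
- by move=> t _; rewrite bilinear_extZl.
Qed.

Lemma bilinear_ext_sumr g a (T : finType) (c : T -> K) (F : T -> {ffun J -> K^o}) :
  bilinear_ext g a (\sum_t c t *: F t) = \sum_t c t *: bilinear_ext g a (F t).
Proof.
apply: (big_ind2 (fun x y => bilinear_ext g a x = y)).
- by have := bilinear_extZr g 0 a 0; rewrite !scale0r.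
- by move=> x y x' y' <- <-; rewrite bilinear_extDr.
- by move=> t _; rewrite bilinear_extZr.
Qed.

End Bilinear.

Arguments basis K {T} t.

Lemma basis_sum (K : fieldType) (T : finType) (v : {ffun T -> K^o}) :
  v = \sum_t (v t : K) *: basis K t.
Proof.
apply/ffunP => u; rewrite sum_ffunE (bigD1 u) //= !ffunE eqxx [_ *: _]mulr1.
rewrite big1 ?addr0 // => t ne; rewrite !ffunE eq_sym (negPf ne).
exact: mulr0.
Qed.

Section MonoidAlgebra.
Variables (K : fieldType) (n : nat).

(* The monoid algebra of OD n: its underlying K-space is that of functions
   OD n -> K, with the convolution product.                                   *)
Definition kOD : Type := {ffun OD n -> K^o}.

HB.instance Definition _ := GRing.Lmodule.copy kOD {ffun OD n -> K^o}.

Definition kOD_mul (a b : kOD) : kOD :=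
  bilinear_ext (fun s t : OD n => basis K (s * t)%g) a b.

Definition kOD_one : kOD := basis K (1%g : OD n).

Fact kOD_mulDl : left_distributive kOD_mul +%R.
Proof. by move=> a b c; apply: bilinear_extDl. Qed.

Fact kOD_mulDr : right_distributive kOD_mul +%R.
Proof. by move=> a b c; apply: bilinear_extDr. Qed.

Fact kOD_mulA : associative kOD_mul.
Proof.
move=> a b c; rewrite /kOD_mul (basis_sum (T := OD n) a) (basis_sum (T := OD n) b) (basis_sum (T := OD n) c).
rewrite !bilinear_ext_suml; apply: eq_bigr => s _; congr (_ *: _).
rewrite [LHS]bilinear_ext_sumr [X in _ = bilinear_ext _ X _]bilinear_ext_sumr.
rewrite bilinear_ext_suml.
apply: eq_bigr => t _; congr (_ *: _).
rewrite !bilinear_ext_sumr; apply: eq_bigr => u _; congr (_ *: _).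
by rewrite !bilinear_ext_basis mulgA.
Qed.

Fact kOD_mul1 : left_id kOD_one kOD_mul.
Proof.
move=> a; rewrite /kOD_mul [in RHS](basis_sum (T := OD n) a) {1}(basis_sum (T := OD n) a).
rewrite bilinear_ext_sumr; apply: eq_bigr => s _.
by rewrite bilinear_ext_basis mul1g.
Qed.

Fact kOD_mulr1 : right_id kOD_one kOD_mul.
Proof.
move=> a; rewrite /kOD_mul [in RHS](basis_sum (T := OD n) a) {1}(basis_sum (T := OD n) a).
rewrite bilinear_ext_suml; apply: eq_bigr => s _.
by rewrite bilinear_ext_basis mulg1.
Qed.

Fact kOD_one_neq0 : kOD_one != 0.
Proof. by apply/eqP => /ffunP/(_ 1%g)/eqP; rewrite !ffunE eqxx oner_eq0. Qed.

HB.instance Definition _ := GRing.Zmodule_isNzRing.Build kOD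
  kOD_mulA kOD_mul1 kOD_mulr1 kOD_mulDl kOD_mulDr kOD_one_neq0.

Fact kOD_scaleAl (c : K) (a b : kOD) : c *: (a * b) = (c *: a) * b.
Proof. by rewrite [RHS]bilinear_extZl. Qed.

HB.instance Definition _ := GRing.Lmodule_isLalgebra.Build K kOD kOD_scaleAl.

Fact kOD_scaleAr (c : K) (a b : kOD) : c *: (a * b) = a * (c *: b).
Proof. by rewrite [RHS]bilinear_extZr. Qed.

HB.instance Definition _ := GRing.Lalgebra_isAlgebra.Build K kOD kOD_scaleAr.

End MonoidAlgebra.

Section LModule.
Variables (K : fieldType) (n : nat) (X : {set 'I_n}).

Definition Lclass : Type := {f : OD n | kernel_set f == X}.

HB.instance Definition _ := Finite.on Lclass.
HB.instance Definition _ := SubType.on Lclass.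

(* The same carrier bears two module structures: kL is the K-vector space and
   kLmod is the left kOD-module, two types because the scalars differ.        *)
Definition kL : Type := {ffun Lclass -> K^o}.
Definition kLmod : Type := kL.

HB.instance Definition _ := Vector.copy kL {ffun Lclass -> K^o}.
HB.instance Definition _ := GRing.Zmodule.copy kLmod kL.

Definition act_basis (s : OD n) (x : Lclass) : kL :=
  if insub (s * val x)%g is Some y then basis K (y : Lclass) else 0.

Definition kL_act (a : kOD K n) (v : kL) : kL := bilinear_ext act_basis a v.

Lemma kL_actA_basis s t x :
  kL_act (basis K s) (kL_act (basis K t) (basis K x)) =
  kL_act (basis K (s * t)%g) (basis K x).
Proof.
rewrite /kL_act !bilinear_ext_basis [act_basis t x]/act_basis.
case: insubP => [y ky yE | nk].
  by rewrite bilinear_ext_basis /act_basis yE mulgA.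
rewrite /act_basis -mulgA insubN.
  by have := bilinear_extZr act_basis 0 (basis K s) 0; rewrite !scale0r.
apply: contra nk => /eqP kst; rewrite eqEsubset.
have /eqP kx := valP x; have := kernel_set_mul t (val x); rewrite kx => ->.
by have := kernel_set_mul s (t * val x)%g; rewrite kst.
Qed.

Fact kL_actA a b (v : kLmod) : kL_act a (kL_act b v) = kL_act (a * b) v.
Proof.
have mulE : a * b =
    \sum_s (a s : K) *: \sum_t (b t : K) *: basis K (s * t)%g :> {ffun OD n -> K^o}.
  rewrite [LHS]/(kOD_mul a b) /kOD_mul.
  rewrite {1}(basis_sum (T := OD n) a).
  rewrite bilinear_ext_suml; apply: eq_bigr => s _; congr (_ *: _).
  rewrite {1}(basis_sum (T := OD n) b) bilinear_ext_sumr.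
  by apply: eq_bigr => t _; rewrite bilinear_ext_basis.
rewrite /kL_act mulE; rewrite {1}(basis_sum (T := OD n) a) !bilinear_ext_suml.
apply: eq_bigr => s _; congr (_ *: _).
rewrite {1}(basis_sum (T := OD n) b) !bilinear_ext_suml bilinear_ext_sumr.
apply: eq_bigr => t _; congr (_ *: _).
rewrite (basis_sum (T := Lclass) v) !bilinear_ext_sumr.
apply: eq_bigr => x _; congr (_ *: _).
exact: kL_actA_basis.
Qed.

Fact kL_act1 : left_id 1 (kL_act : kOD K n -> kLmod -> kLmod).
Proof.
move=> v; rewrite [LHS]/(kL_act _ _) /kL_act [in RHS](basis_sum (T := Lclass) v).
rewrite {1}(basis_sum (T := Lclass) v) bilinear_ext_sumr; apply: eq_bigr => x _.
by rewrite bilinear_ext_basis /act_basis mul1g valK.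
Qed.

Fact kL_actDr : right_distributive (kL_act : kOD K n -> kLmod -> kLmod) +%R.
Proof. by move=> a u v; apply: bilinear_extDr. Qed.

Fact kL_actDl (v : kLmod) :
  {morph (fun a => kL_act a v : kLmod) : a b / a + b}.
Proof. by move=> a b; apply: bilinear_extDl. Qed.

HB.instance Definition _ := GRing.Zmodule_isLmodule.Build (kOD K n) kLmod
  kL_actA kL_act1 kL_actDr kL_actDl.

Lemma kL_act_scalar (c : K) (v : kLmod) : (c%:A : kOD K n) *: v = c *: (v : kL).
Proof.
rewrite [LHS]/(kL_act _ _) /kL_act bilinear_extZl.
exact: (congr1 (fun w : kL => c *: w) (kL_act1 v)).
Qed.

Definition rho (s : OD n) : 'End(kL) := linfun (kL_act (basis K s)).

Lemma rhoE s v : rho s v = kL_act (basis K s) v.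
Proof.
have lin : linear (kL_act (basis K s)).
  by move=> c u w; rewrite /kL_act bilinear_extDr bilinear_extZr.
pose M := GRing.isLinear.Build _ _ _ _ _ lin.
pose L : {linear kL -> kL} := HB.pack (kL_act (basis K s)) M.
exact: (lfunE L).
Qed.

End LModule.

Section ModuleHom.
Variables (K : fieldType) (n : nat) (Y X : {set 'I_n}).

Definition commutator (s : OD n) (F : 'Hom(kL K Y, kL K X)) :
    'Hom(kL K Y, kL K X) :=
  (F \o rho K Y s)%VF - (rho K X s \o F)%VF.

(* Hom(k L_Y, k L_X) as a K-vector space: the K-linear maps that commute with
   every s in OD n.  By modHomP and modHom_total below, these are exactly the
   homomorphisms of left kOD-modules.                                         *)
Definition modHom : {vspace 'Hom(kL K Y, kL K X)} :=
  (\bigcap_(s : OD n) lker (linfun (commutator s)))%VS.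

Lemma modHomP (F : 'Hom(kL K Y, kL K X)) :
  F \in modHom <-> linear (F : kLmod K Y -> kLmod K X).
Proof.
have commE s : linfun (commutator s) F = commutator s F.
  have lin : linear (commutator s).
    move=> c u w; rewrite /commutator comp_lfunDl comp_lfunDr.
    by rewrite -comp_lfunZl -comp_lfunZr scalerBr opprD addrACA.
  pose M := GRing.isLinear.Build _ _ _ _ _ lin.
  pose L : {linear 'Hom(kL K Y, kL K X) -> 'Hom(kL K Y, kL K X)} :=
    HB.pack (commutator s) M.
  exact: (lfunE L).
have memE : F \in modHom <->
    forall s v, F (kL_act (basis K s) v) = kL_act (basis K s) (F v).
  rewrite memvE; split=> [/subv_bigcapP H s v|H].
    have := H s isT; rewrite -memvE memv_ker commE subr_eq0 => /eqP/lfunP/(_ v).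
    by rewrite !lfunE /= !rhoE.
  apply/subv_bigcapP => s _; rewrite -memvE memv_ker commE subr_eq0.
  by apply/eqP/lfunP => v; rewrite !lfunE /= !rhoE.
apply: (iff_trans memE); split=> [H a u v | H s v]; last first.
  by have := H (basis K s) v 0; rewrite !addr0 linear0 addr0.
have actE : F (kL_act a u) = kL_act a (F u).
  rewrite /kL_act (basis_sum (T := OD n) a) !bilinear_ext_suml linear_sum.
  by apply: eq_bigr => s _; rewrite linearZ; congr (_ *: _); apply: H.
by rewrite [LHS](linearD F); congr (_ + _); exact: actE.
Qed.

Lemma modHom_total (G : {linear kLmod K Y -> kLmod K X}) :
  exists2 F, F \in modHom & forall v, F v = G v.
Proof.
have lin : linear (G : kL K Y -> kL K X).
  move=> c u v; have := linearP G (c%:A) u v.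
  by rewrite !kL_act_scalar.
pose M := GRing.isLinear.Build _ _ _ _ _ lin.
pose L : {linear kL K Y -> kL K X} := HB.pack (G : kL K Y -> kL K X) M.
have LE v : linfun L v = G v by rewrite lfunE.
exists (linfun L) => //; apply/modHomP => a u v; rewrite !LE.
exact: linearP.
Qed.

End ModuleHom.

(* Main.v *)
From HB Require Import structures.
Require Import Defs.
From mathcomp Require Import all_boot all_order all_fingroup all_algebra.
From mathcomp Require Import zify.

Set Implicit Arguments.
Unset Strict Implicit.
Unset Printing Implicit Defensive.

Import GRing.Theory.
Local Open Scope ring_scope.

(** The class L_Y contains the idempotent e_Y sending a point to the largest
    element of Y not above it, every f in L_Y satisfies f e_Y = f, and the maps
    t = t e_Y outside L_Y are those whose kernel set is strictly contained in Y.
    Hence k L_Y is generated by e_Y, and a homomorphism F to k L_X amounts to a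
    vector v = F(e_Y) with e_Y v = v and t v = 0 whenever the kernel set of t is
    a proper subset of Y ([modHom_of_vector] gives the direction that needs a
    construction). The proof shows that the coordinates of v at the elements of
    Htilde Y X parametrize these vectors freely.

    The coordinates determine v ([vanishing]). Since e_Y v = v, only maps with
    image in Y occur in v. Let h be such a map and Z its image with the least
    point added. If Z = Y, then h is in Htilde Y X. Otherwise e_Z v = 0, and the
    coefficient of h in this equation is v(h) plus the sum of the v(h') over the
    h' distinct from h with e_Z h' = h. All of these lie above h pointwise, so a
    downward induction on the sum of the values expresses everything through
    Htilde Y X.

    The coordinates are arbitrary. For h in Htilde Y X put
    v_h = sum over u in Y of (-1)^(number of elements of Y below u) d_u h,
    where d_u moves the points of Y up to u one step down in Y. The only term of
    v_h in Htilde Y X is h itself, because for u not the least point d_u never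
    takes the value u on Y ([alternating_coef]). If the kernel set of t is a
    proper subset of Y, then t merges two neighbours of Y: their two terms
    cancel in t v_h, and t d_u h has smaller rank for every other u
    ([skip_collapse], [alternating_annihilated]). *)

(** * Kernel sets and images of monotone maps *)

Section Kernels.
Variable n : nat.
Implicit Types f s t h : OD n.

Lemma od_ext f h : (forall z, f z = h z) -> f = h.
Proof. by move=> E; apply/val_inj/ffunP. Qed.

Lemma od_const_between t (a b c : 'I_n) :
  (a <= b)%N -> (b <= c)%N -> t a = t c -> t b = t a.
Proof.
move=> ab bc Eac; apply/val_inj/eqP; rewrite eqn_leq.
have /orP[/order_preservingP H|/order_reversingP H] := od_monotone t.
  by rewrite {1}Eac !H.
by rewrite {2}Eac !H.
Qed.

Lemma kernel_setP f (i : 'I_n) :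
  reflect (forall j, f j = f i -> (i <= j)%N) (i \in kernel_set f).
Proof.
rewrite inE; apply: (iffP forallP) => [H j Ej|H j].
  by have /implyP := H j; apply; apply/eqP.
by apply/implyP => /eqP/H.
Qed.

Lemma kernel_class_min f (j : 'I_n) :
  exists m : 'I_n, [/\ m \in kernel_set f, f m = f j & (m <= j)%N].
Proof.
case: (@arg_minnP _ j (fun i => f i == f j) (fun i => i : nat) (eqxx _)).
move=> m /eqP Em minm; exists m; split => //; last exact: minm.
by apply/kernel_setP => i Ei; apply: minm; rewrite Ei Em.
Qed.

Lemma kernel_set_inj f : {in kernel_set f &, injective f}.
Proof.
move=> i j /kernel_setP ki /kernel_setP kj E.
by apply/val_inj/eqP; rewrite eqn_leq ki ?kj.
Qed.

Lemma card_image_set f : #|image_set f| = #|kernel_set f|.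
Proof.
rewrite -(card_in_imset (@kernel_set_inj f)); apply: eq_card => w.
apply/imsetP/imsetP => [[i _ ->]|[i _ ->]]; last by exists i.
by have [m [km Em _]] := kernel_class_min f i; exists m.
Qed.

(** A value merged by [s] makes the larger of two class minima of [h] lose its
    minimality, so composing on the left keeps the kernel only if [s] is
    injective on the image. *)
Lemma kernel_set_mul_inj s h (i j : 'I_n) :
  kernel_set (s * h)%g = kernel_set h -> s (h i) = s (h j) -> h i = h j.
Proof.
move=> Ek Es.
have [a [ka Ea _]] := kernel_class_min h i.
have [b [kb Eb _]] := kernel_class_min h j.
rewrite -Ea -Eb; congr (h _); apply: (@kernel_set_inj (s * h)%g).
- by rewrite Ek.
- by rewrite Ek.
- by rewrite !od_mulE Ea Eb.
Qed.

End Kernels.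

(** * Retractions and shifts of a set containing the least point *)

Section Floor.
Variables (n : nat) (hn : (0 < n)%N) (Y : {set 'I_n}).
Hypothesis Y1 : Defs.one hn \in Y.

Definition floor (k : nat) : 'I_n :=
  [arg max_(w > Defs.one hn | (w \in Y) && (w <= k)%N) (w : nat)].

Lemma floorP k :
  [/\ floor k \in Y, (floor k <= k)%N
    & forall w : 'I_n, w \in Y -> (w <= k)%N -> (w <= floor k)%N].
Proof.
rewrite /floor; case: arg_maxnP => [|w /andP[wY wk] wmax]; first by rewrite Y1.
by split=> // w' w'Y w'k; apply: wmax; rewrite w'Y.
Qed.

Lemma floor_in k : floor k \in Y. Proof. by case: (floorP k). Qed.

Lemma floor_le k : (floor k <= k)%N. Proof. by case: (floorP k). Qed.

Lemma le_floor k (w : 'I_n) : w \in Y -> (w <= k)%N -> (w <= floor k)%N.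
Proof. by case: (floorP k) => _ _; apply. Qed.

Lemma floor_mono k l : (k <= l)%N -> (floor k <= floor l)%N.
Proof.
by move=> kl; apply: le_floor (floor_in k) (leq_trans (floor_le k) kl).
Qed.

Lemma floor_id (w : 'I_n) : w \in Y -> floor w = w.
Proof.
by move=> wY; apply/val_inj/eqP; rewrite /= eqn_leq floor_le le_floor.
Qed.

Fact retract_subproof :
  order_preserving [ffun z : 'I_n => floor z] ||
  order_reversing [ffun z : 'I_n => floor z].
Proof.
apply/orP; left; apply/order_preservingP => i j ij.
by rewrite !ffunE floor_mono.
Qed.

Definition retract : OD n := MkOD retract_subproof.

Lemma retractE z : retract z = floor z. Proof. exact: ffunE. Qed.

Lemma kernel_set_retract : kernel_set retract = Y.
Proof.
apply/setP => i; apply/kernel_setP/idP => [|iY j].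
  move/(_ (floor i)); rewrite !retractE floor_id ?floor_in // => /(_ erefl) le.
  have -> : i = floor i; last exact: floor_in.
  by apply/val_inj/eqP; rewrite /= eqn_leq le floor_le.
by rewrite !retractE (floor_id iY) => <-; apply: floor_le.
Qed.

Lemma mul_retract (t : OD n) : kernel_set t \subset Y -> (t * retract)%g = t.
Proof.
move=> /subsetP tY; apply: od_ext => z.
rewrite od_mulE retractE.
have [m [km Em mz]] := kernel_class_min t z.
rewrite -Em; apply: (od_const_between _ (floor_le z)) => //.
by apply: le_floor => //; apply: tY.
Qed.

Fact skip_subproof (u : 'I_n) :
  order_preserving [ffun z : 'I_n => floor (z - (z <= u)%N)] ||
  order_reversing [ffun z : 'I_n => floor (z - (z <= u)%N)].
Proof.
apply/orP; left; apply/order_preservingP => i j ij.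
by rewrite !ffunE floor_mono //; lia.
Qed.

(** For [u] in [Y], this sends the points of [Y] other than the least
    bijectively onto [Y] without [u]: those up to [u] move to their predecessor
    in [Y], the others stay. The truncated subtraction fixes the least point. *)
Definition skip (u : 'I_n) : OD n := MkOD (skip_subproof u).

Lemma skipE u z : skip u z = floor (z - (z <= u)%N). Proof. exact: ffunE. Qed.

Lemma skip_one : skip (Defs.one hn) = retract.
Proof.
apply: od_ext => z; rewrite skipE retractE; congr floor.
by rewrite /=; lia.
Qed.

Lemma mul_retract_skip u : (retract * skip u)%g = skip u.
Proof.
apply: od_ext => z; rewrite od_mulE retractE.
by apply: floor_id; rewrite skipE floor_in.
Qed.

Lemma skip_neq u z : u != Defs.one hn -> z \in Y -> skip u z != u.
Proof.
move=> u1 zY; apply: contraNneq u1; rewrite skipE.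
have [zu|uz] := leqP z u => E; last first.
  by move: uz; rewrite -E subn0 floor_id ?ltnn.
apply/eqP/val_inj => /=; have := floor_le (z - 1); rewrite E.
by lia.
Qed.

(** A point [y] of [Y] outside the kernel set of [t] is merged by [t] with its
    predecessor [y0] in [Y]. The maps [skip y0] and [skip y] differ only on the
    points of ]y0, y], where their values lie between [y0] and [y], so [t] does
    not distinguish them. Any other [skip u] takes both values [y0] and [y] at
    points of [Y] other than the least, so [t * skip u] merges these points. *)
Lemma skip_collapse (t : OD n) :
  kernel_set t \proper Y ->
  exists y0 y : 'I_n,
    [/\ y0 \in Y, y \in Y, (y0 < y)%N
      & forall w : 'I_n, w \in Y -> (w < y)%N -> (w <= y0)%N]
    /\ [/\ (t * skip y0)%g = (t * skip y)%g
      & forall u, u \in Y -> u != y0 -> u != y ->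
        exists a b : 'I_n,
          [/\ a \in Y :\ Defs.one hn, b \in Y :\ Defs.one hn,
              skip u a != skip u b & t (skip u a) = t (skip u b)]].
Proof.
case/properP=> /subsetP tY [y yY yk].
have [m [km Em my]] := kernel_class_min t y.
have {}my : (m < y)%N.
  by rewrite ltn_neqAle my andbT; apply: contraNneq yk => /val_inj <-.
have y0y : (floor (y - 1) < y)%N by have := floor_le (y - 1); lia.
have my0 : (m <= floor (y - 1))%N by apply: le_floor; [exact: tY | lia].
set y0 := floor (y - 1) in y0y my0 *.
have y0Y : y0 \in Y by apply: floor_in.
have y0max (w : 'I_n) : w \in Y -> (w < y)%N -> (w <= y0)%N.
  by move=> wY wy; apply: le_floor => //; lia.
have tc (z : 'I_n) : (y0 <= z)%N -> (z <= y)%N -> t z = t y.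
  by move=> y0z zy; rewrite -Em; apply: od_const_between Em => //; lia.
exists y0, y; split; split => //.
  apply: od_ext => z; rewrite !od_mulE !skipE.
  have [zy0|y0z] := leqP z y0; first by rewrite (_ : (z <= y)%N) //; lia.
  have [zy|yz] := leqP z y; last by [].
  rewrite !tc //; try (apply: le_floor => //; lia).
    by apply: leq_trans (floor_le _) _; lia.
  by apply: leq_trans (floor_le _) _; lia.
move=> u uY uy0 uy.
have inY1 (a b : 'I_n) : a \in Y -> (b < a)%N -> a \in Y :\ Defs.one hn.
  move=> aY ba; rewrite !inE aY andbT.
  by apply: contraTneq ba => ->; rewrite -leqNgt.
have neq (a b : 'I_n) : (a < b)%N -> a != b.
  by apply: contraTneq => ->; rewrite ltnn.
have {uy0 uy} [uy0|yu] : (u < y0)%N \/ (y < u)%N.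
  have [uLy|] := ltnP u y.
    by left; rewrite ltn_neqAle y0max // andbT.
  by rewrite leq_eqVlt => /orP[/eqP/val_inj E|]; [rewrite E eqxx in uy | right].
- (* Both points lie above [u] and are fixed by [skip u]. *)
  exists y0, y; rewrite (inY1 y0 u) // (inY1 y y0) // !skipE.
  rewrite [(y0 <= u)%N]leqNgt uy0 [(y <= u)%N]leqNgt (ltn_trans uy0 y0y).
  rewrite !subn0 !floor_id //.
  by split=> //; [exact: neq | apply: tc => //; apply: ltnW].
- (* [skip u] moves [y] to [y0] and the successor [b] of [y] in [Y] to [y]. *)
  case: (@arg_minnP _ u (fun w => (w \in Y) && (y < w)%N) (fun w => w : nat)).
    by rewrite uY.
  move=> b /andP[bY yb] bmin.
  have bu : (b <= u)%N by apply: bmin; rewrite uY.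
  have fb : floor (b - 1) = y.
    apply/val_inj/eqP; rewrite /= eqn_leq [X in _ && X]le_floor //; last by lia.
    rewrite andbT leqNgt; apply/negP => yf.
    have := bmin (floor (b - 1)); rewrite floor_in yf => /(_ isT).
    by have := floor_le (b - 1); lia.
  exists y, b; rewrite (inY1 y y0) // (inY1 b y) // !skipE bu ltnW //.
  by rewrite -/y0 fb; split=> //; [exact: neq | apply: tc => //; apply: ltnW].
Qed.

End Floor.

(** * Coordinates of the action and of homomorphisms *)

Section Action.
Variables (K : fieldType) (n : nat).
Implicit Types (X Y : {set 'I_n}) (s t : OD n).

Lemma act_basis_coef X s (x h : Lclass X) :
  act_basis K s x h = (s * val x == val h)%g%:R.
Proof.
rewrite /act_basis; case: insubP => [y _ Ey | nk]; first by rewrite ffunE -Ey eq_sym.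
rewrite ffunE; case: eqP => // E; case/negP: nk; rewrite E; exact: valP h.
Qed.

Lemma kL_act_basisE X s (v : kL K X) :
  kL_act (basis K s) v = \sum_x v x *: act_basis K s x.
Proof.
rewrite /kL_act {1}(basis_sum v) bilinear_ext_sumr.
by apply: eq_bigr => x _; rewrite bilinear_ext_basis.
Qed.

Lemma kL_act_coef X s (v : kL K X) (h : Lclass X) :
  kL_act (basis K s) v h = \sum_(x | (s * val x == val h)%g) v x.
Proof.
rewrite kL_act_basisE sum_ffunE [RHS]big_mkcond; apply: eq_bigr => x _.
rewrite ffunE act_basis_coef; case: eqP => _; [exact: mulr1 | exact: mulr0].
Qed.

Lemma kL_act_act_basis X s t (x : Lclass X) :
  kL_act (basis K s) (act_basis K t x) = act_basis K (s * t)%g x.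
Proof.
have := kL_actA_basis K s t x.
by rewrite /kL_act !bilinear_ext_basis.
Qed.

Lemma act_basis_eq0 X s (x : Lclass X) :
  kernel_set (s * val x)%g != X -> act_basis K s x = 0.
Proof. by move=> nk; rewrite /act_basis insubN. Qed.

Lemma act_basis_id X s (x y : Lclass X) :
  (s * val x)%g = val y -> act_basis K s x = basis K y.
Proof. by move=> E; rewrite /act_basis E valK. Qed.

Lemma modHom_act X Y (F : 'Hom(kL K Y, kL K X)) a v :
  F \in modHom K Y X -> F (kL_act a v) = kL_act a (F v).
Proof.
move=> /modHomP HF; have := HF a v 0; rewrite [RHS]addrC.
by rewrite linear0 add0r addr0.
Qed.

(** The map x |-> x v on [Lclass Y] respects the action: when s x leaves the
    class, it is 0 in [kL K Y], and its kernel set is a proper subset of [Y], so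
    that the hypothesis makes s (x v) vanish as well. *)
Lemma modHom_of_vector X Y (v : kL K X) :
  (forall t, kernel_set t \proper Y -> kL_act (basis K t) v = 0) ->
  exists2 F, F \in modHom K Y X &
    forall x : Lclass Y, F (basis K x) = kL_act (basis K (val x)) v.
Proof.
move=> v0; pose g (x : Lclass Y) (w : Lclass X) := act_basis K (val x) w.
have lin : linear (fun u : kL K Y => bilinear_ext g u v : kL K X).
  by move=> c u w; rewrite bilinear_extDl bilinear_extZl.
pose M := GRing.isLinear.Build _ _ _ _ _ lin.
pose L : {linear kL K Y -> kL K X} :=
  HB.pack (fun u : kL K Y => bilinear_ext g u v : kL K X) M.
have [F FE] : exists F : 'Hom(kL K Y, kL K X), forall u, F u = bilinear_ext g u v.
  by exists (linfun L) => u; rewrite lfunE.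
have F_basis x : F (basis K x) = kL_act (basis K (val x)) v.
  rewrite FE kL_act_basisE {1}(basis_sum v) bilinear_ext_sumr.
  by apply: eq_bigr => w _; rewrite bilinear_ext_basis.
have F_act s x : F (act_basis K s x) =
    kL_act (basis K s) (F (basis K x)).
  rewrite F_basis [kL_act _ v]kL_act_basisE.
  rewrite [RHS](bilinear_ext_sumr (@act_basis K n X) _ v).
  under eq_bigr do rewrite [bilinear_ext _ _ _]kL_act_act_basis.
  rewrite -kL_act_basisE /act_basis; case: insubP => [y _ Ey | nk].
    by rewrite F_basis Ey.
  rewrite linear0 v0 // properEneq nk.
  by have := kernel_set_mul s (val x); rewrite (eqP (valP x)).
have F_lin a u : F (kL_act a u) = kL_act a (F u).
  rewrite /kL_act (basis_sum (T := OD n) a) !bilinear_ext_suml linear_sum.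
  apply: eq_bigr => s _; rewrite linearZ; congr (_ *: _).
  rewrite (basis_sum (T := Lclass Y) u) bilinear_ext_sumr !linear_sum.
  under [X in _ = bilinear_ext _ _ X]eq_bigr do rewrite linearZ.
  rewrite bilinear_ext_sumr; apply: eq_bigr => x _.
  by rewrite linearZ; congr (_ *: _); rewrite bilinear_ext_basis; apply: F_act.
exists F => //; apply/modHomP => a u w.
by rewrite [LHS](linearD F); congr (_ + _); exact: F_lin.
Qed.

End Action.

(** * Alternating sums *)

Section Alternating.
Variables (K : fieldType) (n : nat) (hn : (0 < n)%N) (X Y : {set 'I_n}).
Hypothesis Y1 : Defs.one hn \in Y.

Lemma in_HtildeE (h : OD n) :
  (h \in Htilde hn Y X) =
    (kernel_set h == X) && (image_set h :|: [set Defs.one hn] == Y).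
Proof.
rewrite inE; apply/existsP/andP => [[alpha /existsP[W]]|[kh imh]].
  by case/and3P=> /and3P[_ -> /eqP ->] _ ->.
exists (order_preserving h); apply/existsP; exists (image_set h).
rewrite /is_fWX kh imh eqxx card_image_set (eqP kh) eqxx !andbT.
by have := od_monotone h; case: (order_preserving h).
Qed.

Definition position (u : 'I_n) := #|[set w in Y | (w < u)%N]|.

(** When the image of [h] is [Y] without its least point, the maps
    [skip u * h], for [u] in [Y], are those of the same orientation and kernel
    whose image is [Y] without [u], and [alternating h] is their alternating
    sum. When the image of [h] is [Y], only the term [h] remains. *)
Definition alternating (h : Lclass X) : kL K X :=
  \sum_(u in Y) (-1) ^+ position u *: act_basis K (skip Y1 u) h.

Lemma kL_act_alternating (t : OD n) h :
  kL_act (basis K t) (alternating h) =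
    \sum_(u in Y) (-1) ^+ position u *: act_basis K (t * skip Y1 u)%g h.
Proof.
rewrite -rhoE linear_sum; apply: eq_bigr => u _.
by rewrite linearZ /= rhoE kL_act_act_basis.
Qed.

Lemma Htilde_image (h : OD n) a :
  h \in Htilde hn Y X -> a \in Y :\ Defs.one hn -> exists i, h i = a.
Proof.
rewrite in_HtildeE => /andP[_ /eqP <-]; rewrite !inE.
by case/andP=> /negPf -> /[!orbF] /imsetP[i _ ->]; exists i.
Qed.

Lemma Htilde_val_in (h : OD n) i : h \in Htilde hn Y X -> h i \in Y.
Proof.
rewrite in_HtildeE => /andP[_ /eqP <-].
by rewrite inE imset_f.
Qed.

(** The maps [t * skip u * h] lose rank except for the two neighbours merged by
    [t], whose terms agree and carry opposite signs. *)
Lemma alternating_annihilated (t : OD n) (h : Lclass X) :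
  val h \in Htilde hn Y X -> kernel_set t \proper Y ->
  kL_act (basis K t) (alternating h) = 0.
Proof.
move=> hH /(skip_collapse Y1)[y0 [y [[y0Y yY y0y y0max] [Et killed]]]].
have yy0 : y != y0 by apply: contraTneq y0y => ->; rewrite ltnn.
have pos_y : position y = (position y0).+1.
  rewrite /position (cardsD1 y0) inE y0Y y0y add1n; congr _.+1.
  apply: eq_card => w; rewrite !inE; case: (boolP (w \in Y)) => wY /=; last first.
    by rewrite andbF.
  apply/andP/idP => [[wy0 /(y0max _ wY)]|wy0].
    by rewrite leq_eqVlt => /orP[/eqP/val_inj E|//]; rewrite E eqxx in wy0.
  split; last exact: ltn_trans wy0 y0y.
  by apply: contraTneq wy0 => ->; rewrite ltnn.
rewrite kL_act_alternating (bigD1 y0) //= (bigD1 y) /=; last by rewrite yY.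
rewrite big1 => [|u /andP[/andP[uY uy0] uy]].
  by rewrite addr0 Et pos_y exprS mulN1r scaleNr subrr.
have [a [b [aY bY neq_ab Eab]]] := killed u uY uy0 uy.
have [i Ei] := Htilde_image hH aY; have [j Ej] := Htilde_image hH bY.
rewrite act_basis_eq0 ?scaler0 //; apply: contraNneq neq_ab => Ek.
rewrite -Ei -Ej; suff -> : val h i = val h j by [].
apply: (@kernel_set_mul_inj n (t * skip Y1 u)%g); first by rewrite Ek (eqP (valP h)).
by rewrite !od_mulE Ei Ej.
Qed.

(** No [skip u] other than the retraction takes the value [u], while every map
    in [Htilde hn Y X] takes all values in [Y] except possibly the least. *)
Lemma alternating_coef (h h' : Lclass X) :
  val h \in Htilde hn Y X -> val h' \in Htilde hn Y X ->
  kL_act (basis K (retract Y1)) (alternating h) h' = (h' == h)%:R.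
Proof.
move=> hH h'H; rewrite kL_act_alternating sum_ffunE (bigD1 (Defs.one hn)) //=.
rewrite big1 => [|u /andP[uY u1]]; rewrite ffunE act_basis_coef mul_retract_skip.
  have -> : position (Defs.one hn) = 0%N.
    by apply: eq_card0 => w; rewrite !inE ltn0 andbF.
  rewrite scale1r addr0 skip_one eq_sym -[h' == h]val_eqE; congr (_ == _)%:R.
  apply: od_ext => z; rewrite od_mulE retractE floor_id //.
  exact: Htilde_val_in hH.
case: eqP => [E|_]; last exact: mulr0.
have uY1 : u \in Y :\ Defs.one hn by rewrite !inE u1.
have [i] := Htilde_image h'H uY1.
rewrite -E od_mulE => /eqP; rewrite (negPf (skip_neq Y1 u1 _)) //.
exact: Htilde_val_in hH.
Qed.

(** Triangularity: if the image of [h] lies in [Y] and [Z], that image together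
    with the least point, is not all of [Y], then the relation given by
    [retract Z] expresses [v h] through the [v h'] with [h'] above [h]. *)
Lemma vanishing (v : kL K X) :
  kL_act (basis K (retract Y1)) v = v ->
  (forall t : OD n, kernel_set t \proper Y -> kL_act (basis K t) v = 0) ->
  (forall h, val h \in Htilde hn Y X -> v h = 0) ->
  v = 0.
Proof.
move=> v_fix v_ann vH; apply/ffunP => h; rewrite ffunE.
pose height (g : Lclass X) := \sum_i (val g i : nat).
have bound g : (height g <= \sum_(i < n) n)%N.
  by apply: leq_sum => i _; apply: ltnW.
(* Downward induction on [height]. *)
have [m] := ubnP (\sum_(i < n) n - height h).
elim: m => // m IHm in h *; rewrite ltnS => le_m.
have [imY|] := boolP (image_set (val h) \subset Y); last first.
  case/subsetPn=> _ /imsetP[i _ ->] nY.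
  rewrite -v_fix kL_act_coef big1 // => g /eqP Eg; case/negP: nY.
  by rewrite -Eg od_mulE retractE floor_in.
have [hH|hH] := boolP (val h \in Htilde hn Y X); first exact: vH.
set Z := image_set (val h) :|: [set Defs.one hn].
have Z1 : Defs.one hn \in Z by rewrite !inE eqxx orbT.
have ZY : Z \proper Y.
  rewrite properEneq subUset imY sub1set Y1 !andbT.
  by apply: contra hH => EZ; rewrite in_HtildeE EZ andbT (eqP (valP h)).
have := v_ann (retract Z1); rewrite kernel_set_retract => /(_ ZY)/ffunP/(_ h).
have hZ i : val h i \in Z by rewrite inE imset_f.
rewrite kL_act_coef ffunE (bigD1 h) /=; last first.
  by apply/eqP/od_ext => i; rewrite od_mulE retractE floor_id.
rewrite big1 ?addr0 // => g /andP[/eqP Eg neq_gh].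
apply: IHm.
have le_hg i : (val h i <= val g i)%N.
  by have := floor_le Z1 (val g i); rewrite -retractE -od_mulE Eg.
suff lt_hg : (height h < height g)%N by have := bound g; lia.
rewrite (ltn_leqif (leqif_sum (fun i _ => leqif_eq (le_hg i)))).
apply: contra neq_gh => /forallP E; apply/eqP/val_inj/od_ext => i.
by apply/val_inj/esym/eqP; have := E i.
Qed.

End Alternating.

(** * The dimension of the space of homomorphisms *)

Theorem proposition3p10 (n : nat) (hn : (0 < n)%N) (K : fieldType)
    (X Y : {set 'I_n}) (hX : X \in P1 hn) (hY : Y \in P1 hn) :
  \dim (modHom K Y X) = #|Htilde hn Y X|.
Proof.
have Y1 : Defs.one hn \in Y by move: hY; rewrite inE.
have ke : kernel_set (retract Y1) == Y by rewrite kernel_set_retract.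
pose e : Lclass Y := exist _ (retract Y1) ke.
pose S := {h : Lclass X | val h \in Htilde hn Y X}.
pose coords (F : 'Hom(kL K Y, kL K X)) : {ffun S -> K^o} :=
  [ffun h => F (basis K e) (val h)].
have lin : linear coords.
  by move=> c F G; apply/ffunP => h; rewrite !ffunE add_lfunE scale_lfunE !ffunE.
pose M := GRing.isLinear.Build _ _ _ _ _ lin.
pose L : {linear 'Hom(kL K Y, kL K X) -> {ffun S -> K^o}} := HB.pack coords M.
have coordsE F : linfun L F = coords F by rewrite lfunE.
have mul_e (t : OD n) : kernel_set t \subset Y -> (t * val e)%g = t.
  exact: mul_retract.
have ev_act (F : 'Hom(kL K Y, kL K X)) t : F \in modHom K Y X ->
    kL_act (basis K t) (F (basis K e)) = F (act_basis K t e).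
  move=> FH; rewrite -modHom_act // /kL_act.
  by rewrite bilinear_ext_basis.
have inj : (modHom K Y X :&: lker (linfun L) = 0)%VS.
  apply/eqP; rewrite -subv0; apply/subvP => F.
  rewrite memv_cap memv_ker coordsE memv0 => /andP[FH /eqP/ffunP F0].
  have Fe0 : F (basis K e) = 0.
    apply: (vanishing (Y1 := Y1)) => [|t tY|h hH].
    - rewrite ev_act // (@act_basis_id _ _ _ _ _ e) //.
      by rewrite mul_e // kernel_set_retract.
    - rewrite ev_act // act_basis_eq0 ?linear0 // mul_e ?(proper_sub tY) //.
      by move: tY; rewrite properEneq => /andP[].
    - by have := F0 (exist _ h hH); rewrite !ffunE.
  apply/eqP/lfunP => v; rewrite lfunE /= (basis_sum v) linear_sum big1 // => x _.
  rewrite linearZ -(@act_basis_id K _ _ (val x) e).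
    by rewrite /= -ev_act // Fe0 -rhoE linear0 scaler0.
  by rewrite mul_e // (eqP (valP x)).
have surj : (linfun L @: modHom K Y X = fullv)%VS.
  apply/eqP; rewrite eqEsubv subvf /=; apply/subvP => c _.
  rewrite (basis_sum c); apply: memv_suml => h _; apply: memvZ.
  have [F FH FE] := modHom_of_vector
    (fun t => @alternating_annihilated K n hn X Y Y1 t _ (valP h)).
  apply/memv_imgP; exists F => //; rewrite coordsE; apply/ffunP => h'.
  by rewrite !ffunE FE alternating_coef ?(valP h) ?(valP h').
rewrite -(limg_dim_eq inj) surj dimvf /dim /= muln1 card_sig.
rewrite -(card_imset _ val_inj); apply: eq_card => f.
apply/imsetP/idP => [[h hH ->] //|fH].
have kf : kernel_set f == X by move: fH; rewrite in_HtildeE => /andP[].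
by exists (exist _ f kf).
Qed.
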